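(* Let $q\in(0,1)$. Let $\gamma_n(q)=\big(\prod_{l=1}^n(1-q^l)\big)P_n^q(S_n(312))$ for $n\ge0$, let $G_q(t)=\sum_{n=0}^\infty\gamma_n(q)t^n$, and let $r(q)$ be the radius of convergence of this power series. Then $G_q$ satisfies the functional equation $$G_q(t)=\frac1{1-(1-q)\,t\,G_q(qt)},\quad 0\le t<r(q).$$ Furthermore, $$\lim_{t\to r(q)}G_q(t)=\infty,$$ where the limit is taken over $t\in[0,r(q))$.
   Context: $S_n$ is the set of permutations $\sigma=\sigma_1\cdots\sigma_n$ of $[n]=\{1,\dots,n\}$, where $\sigma_i=\sigma(i)$. For $\tau\in S_m$ with $2\le m\le n$, $\sigma\in S_n$ contains $\tau$ as a pattern if there are indices $1\le i_1<\cdots<i_m\le n$ such that for all $1\le j,k\le m$, $\sigma_{i_j}<\sigma_{i_k}$ if and only if $\tau_j<\tau_k$; otherwise $\sigma$ avoids $\tau$. $S_n(\tau)$ is the set of $\sigma\in S_n$ avoiding $\tau$, and $S_n(\tau)=S_n$ if $m>n$. For $q>0$, the Mallows distribution with parameter $q$ is the probability measure on $S_n$ given by $P_n^q(\sigma)=q^{\mathrm{inv}(\sigma)}/Z_n(q)$, where $\mathrm{inv}(\sigma)$ is the number of inversions of $\sigma$, i.e. pairs $i<j$ with $\sigma_i>\sigma_j$, and $Z_n(q)=\sum_{\sigma\in S_n}q^{\mathrm{inv}(\sigma)}$, which for $q\neq 1$ equals $\prod_{k=1}^n\frac{1-q^k}{1-q}$. Conventions: the empty product is $1$ and $S_0$ consists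 of the empty permutation only, so $\gamma_0(q)=1$. The radius of convergence satisfies $1\le r(q)<\infty$. *)

(* Defs.v *)
From HB Require Import structures.
From mathcomp Require Import all_boot all_order all_algebra all_fingroup.
From mathcomp Require Import all_classical all_reals all_analysis.

Set Implicit Arguments.
Unset Strict Implicit.
Unset Printing Implicit Defensive.

Import Order.TTheory GRing.Theory Num.Theory.
Import numFieldNormedType.Exports.

Local Open Scope ring_scope.

(* Permutations of [n] are represented 0-based, as elements of 'S_n: both
   positions and values are shifted down by one. *)

(* For m > n no strictly increasing i exists, so every s avoids t. *)
Definition contains_pattern (m n : nat) (s : 'S_n) (t : 'S_m) : bool :=
  [exists i : {ffun 'I_m -> 'I_n},
     [forall j : 'I_m, forall k : 'I_m, (j < k)%N ==> (i j < i k)%N] &&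
     [forall j : 'I_m, forall k : 'I_m,
        (s (i j) < s (i k))%N == (t j < t k)%N]].

Definition avoiders (m n : nat) (t : 'S_m) : {set 'S_n} :=
  [set s : 'S_n | ~~ contains_pattern s t].

Definition p312_fun (i : 'I_3) : 'I_3 :=
  tnth [tuple Ordinal (isT : (2 < 3)%N);
              Ordinal (isT : (0 < 3)%N);
              Ordinal (isT : (1 < 3)%N)] i.

Lemma p312_fun_inj : injective p312_fun.
Proof.
move=> [[|[|[|//]]] hi] [[|[|[|//]]] hj] /(congr1 val) //= _; exact: val_inj.
Qed.

Definition p312 : 'S_3 := perm p312_fun_inj.

Definition inv_count (n : nat) (s : 'S_n) : nat :=
  #|[set p : 'I_n * 'I_n | (p.1 < p.2)%N && (s p.2 < s p.1)%N]|.

Definition mallows_Z (R : realType) (n : nat) (q : R) : R :=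
  \sum_(s : 'S_n) q ^+ inv_count s.

Definition mallows_pmf (R : realType) (n : nat) (q : R) (s : 'S_n) : R :=
  q ^+ inv_count s / mallows_Z n q.

Definition mallows (R : realType) (n : nat) (q : R) (A : {set 'S_n}) : R :=
  \sum_(s in A) mallows_pmf q s.

Definition gamma312 (R : realType) (q : R) (n : nat) : R :=
  (\prod_(1 <= l < n.+1) (1 - q ^+ l)) * mallows q (avoiders n p312).

Definition pseries_sum (R : realType) (a : R ^nat) (t : R) : R :=
  limn (pseries a t).

Definition pseries_radius (R : realType) (a : R ^nat) : \bar R :=
  ereal_sup [set (`|x|)%:E | x in [set x : R | cvgn (pseries a x)]].

Definition G312 (R : realType) (q t : R) : R := pseries_sum (gamma312 q) t.

Definition r312 (R : realType) (q : R) : \bar R := pseries_radius (gamma312 q).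

(* Main.v *)
Require Import Defs.
From HB Require Import structures.
From mathcomp Require Import all_boot all_order all_algebra all_fingroup.
From mathcomp Require Import all_classical all_reals all_analysis.
From mathcomp Require Import zify ring lra.

(* Build a permutation by prepending letters, from right to left.  Prepending k
   creates k inversions, and keeps a nonempty permutation s 312-avoiding iff
   k <= s 0 + 1.  Hence the inversion enumerator a_n of the 312-avoiders counts
   weighted walks, and decomposing these at their first passages gives
   a_(n+1) = \sum_(i <= n) q^i a_i a_(n-i).  As gamma_n = (1 - q)^n a_n, this is
   G(t) = 1 + h(t) G(t) with h(t) = (1 - q) t G(qt).

   If G were bounded by M on [0, r), then h = 1 - 1/G <= 1 - 1/M there, so r is
   finite.  Now h converges beyond r and is convex, hence h(t) < 1 for some
   t > r; but the partial sums S_n of G satisfy S_(n+1)(t) <= 1 + h(t) S_n(t),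
   so the series converges at t, contradicting the definition of r. *)

Set Implicit Arguments.
Unset Strict Implicit.
Unset Printing Implicit Defensive.

Import Order.TTheory GRing.Theory Num.Theory.
Import numFieldNormedType.Exports.

Local Open Scope classical_set_scope.
Local Open Scope ring_scope.

(** * Occurrences of 312 and inversions when a letter is prepended *)

Lemma contains_p312P (n : nat) (s : 'S_n) :
  reflect (exists i j k : 'I_n,
             [/\ (i < j)%N, (j < k)%N, (s j < s k)%N & (s k < s i)%N])
          (contains_pattern s p312).
Proof.
pose o0 : 'I_3 := Ordinal (isT : (0 < 3)%N).
pose o1 : 'I_3 := Ordinal (isT : (1 < 3)%N).
pose o2 : 'I_3 := Ordinal (isT : (2 < 3)%N).
have [p0 p1 p2] : [/\ p312 o0 = o2, p312 o1 = o0 & p312 o2 = o1].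
  by split; apply: val_inj; rewrite permE.
have o3 (j : 'I_3) : [\/ j = o0, j = o1 | j = o2].
  case: j => [[|[|[|//]]] hj];
    by [constructor 1; apply: val_inj | constructor 2; apply: val_inj
       | constructor 3; apply: val_inj].
apply: (iffP existsP) => [[f /andP[/forallP fi /forallP fs]]|].
  have fiE (j k : 'I_3) : (j < k)%N -> (f j < f k)%N
    by move/forallP: (fi j) => /(_ k)/implyP.
  have fsE (j k : 'I_3) : (s (f j) < s (f k))%N = (p312 j < p312 k)%N.
    by move/forallP: (fs j) => /(_ k)/eqP.
  by exists (f o0), (f o1), (f o2); split; rewrite ?fiE ?fsE ?p0 ?p1 ?p2.
case=> i [j [k [ij jk sjk ski]]].
exists [ffun a : 'I_3 => if a == o0 then i else if a == o1 then j else k].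
apply/andP; split; apply/forallP => a; apply/forallP => b; rewrite !ffunE.
  by case: (o3 a) => ->; case: (o3 b) => -> //=; rewrite ?ij ?jk ?(ltn_trans ij jk).
have sji := ltn_trans sjk ski.
case: (o3 a) => ->; case: (o3 b) => ->; rewrite ?p0 ?p1 ?p2 /=
  ?ltnn ?sjk ?ski ?sji //; by rewrite ltnNge ltnW.
Qed.

(* One more than the first letter, or 0 for the empty permutation: a letter k
   can be prepended to a 312-avoiding s exactly when k <= prefix_cap s. *)
Definition prefix_cap (n : nat) : 'S_n -> nat :=
  match n with 0 => fun _ => 0%N | _.+1 => fun s => (s ord0).+1 end.

Lemma prefix_cap_le (n : nat) (s : 'S_n) : (prefix_cap s <= n)%N.
Proof. by case: n s => [//|n] s /=. Qed.

Lemma ltn_lift (n : nat) (k : 'I_n.+1) (a b : 'I_n) :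
  (lift k a < lift k b)%N = (a < b)%N.
Proof. by rewrite /= /bump; lia. Qed.

Lemma lift_ltn (n : nat) (k : 'I_n.+1) (a : 'I_n) : (lift k a < k)%N = (a < k)%N.
Proof. by rewrite /= /bump; lia. Qed.

(** A new occurrence of 312 uses the letter [k] as its 3. If [k <= s 0 + 1], its 2 lies strictly
    below [s 0], which can then replace [k], so [s] already had an occurrence. If [k > s 0 + 1], the
    letters [s 0] and [s 0 + 1] complete one. *)
Lemma avoiders_lift_perm (n : nat) (k : 'I_n.+1) (s : 'S_n) :
  (lift_perm ord0 k s \in avoiders n.+1 p312) =
  (s \in avoiders n p312) && (k <= prefix_cap s)%N.
Proof.
rewrite !inE -[RHS]negbK negb_and negbK -ltnNge; congr (~~ _).
apply/contains_p312P/orP.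
  case=> i [j [l [ij jl]]].
  case: (unliftP ord0 j) ij jl => [j' ->|-> //].
  case: (unliftP ord0 l) => [l' ->|-> //].
  rewrite !lift_perm_lift.
  case: (unliftP ord0 i) => [i' ->|->].
    rewrite !lift_perm_lift !ltn_lift => ij jl sjl sli.
    by left; apply/contains_p312P; exists i', j', l'.
  rewrite lift_perm_id ltn_lift lift_ltn ltn_lift => _ jl sjl slk.
  case: (boolP (contains_pattern s p312)) => [|av]; [by left|right].
  rewrite ltnNge; apply/negP => kcap; case/negP: av; apply/contains_p312P.
  case: n s k j' l' {i j l} jl sjl slk kcap => [|n] s k j l; first by case: j.
  move=> jl sjl slk /= kcap; exists ord0, j, l.
  have l0 : l != ord0 by apply/eqP => l0; move: jl; rewrite l0.
  have {}l0 : s l != s ord0 by rewrite (inj_eq perm_inj).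
  have sl : (s l < s ord0)%N.
    by rewrite ltn_neqAle l0 -ltnS (leq_trans slk).
  split=> //; rewrite lt0n; apply/eqP => j0.
  have {}j0 : j = ord0 by apply: val_inj.
  by move: (ltn_trans sjl sl); rewrite j0 ltnn.
case=> [/contains_p312P[i [j [l [ij jl sjl sli]]]]|].
  by exists (lift ord0 i), (lift ord0 j), (lift ord0 l);
    rewrite !lift_perm_lift !ltn_lift.
case: n k s => [|n] k s /=; first by case: k => [[]].
move=> sk.
have lt1 : ((s ord0).+1 < n.+1)%N by apply: leq_trans sk _; rewrite -ltnS.
pose l := (s^-1)%g (Ordinal lt1).
have sl : s l = Ordinal lt1 by rewrite permKV.
have l0 : l != ord0.
  apply/eqP => l0; move: sl; rewrite l0 => /(congr1 val)/= /eqP.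
  by rewrite ltn_eqF.
exists ord0, (lift ord0 ord0), (lift ord0 l).
rewrite !lift_perm_lift lift_perm_id !ltn_lift lift_ltn sl /=; split => //.
by rewrite lt0n.
Qed.

Lemma sum_ltn_ord (n k : nat) : (k <= n)%N -> (\sum_(x < n) (x < k) = k)%N.
Proof.
move=> kn; rewrite -(big_mkord xpredT (fun x => nat_of_bool (x < k)%N)).
rewrite (big_cat_nat _ kn) //= (@eq_big_nat _ _ _ 0 k _ (fun => 1%N)).
  rewrite sum_nat_const_nat muln1 subn0 big_nat_cond big1 ?addn0 //.
  by move=> i /andP[/andP[ki _] _]; rewrite ltnNge ki.
by move=> i /andP[_ ->].
Qed.

Lemma inv_countE (n : nat) (s : 'S_n) :
  inv_count s = (\sum_(i < n) \sum_(j < n) ((i < j) && (s j < s i)))%N.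
Proof.
rewrite pair_big /inv_count cardsE -sum1_card big_mkcond /=.
by apply: eq_bigr => p _; rewrite unfold_in /=; case: (_ && _).
Qed.

Lemma inv_count_lift_perm (n : nat) (k : 'I_n.+1) (s : 'S_n) :
  inv_count (lift_perm ord0 k s) = (k + inv_count s)%N.
Proof.
rewrite !inv_countE big_ord_recl; congr (_ + _)%N.
  rewrite big_ord_recl ltnn add0n lift_perm_id.
  under eq_bigr do rewrite lift_perm_lift lift_ltn.
  have kn : (k <= n)%N by rewrite -ltnS.
  rewrite -[RHS](sum_ltn_ord kn).
  exact: esym (reindex_inj (@perm_inj _ s)).
apply: eq_bigr => i _; rewrite big_ord_recl add0n.
by apply: eq_bigr => j _; rewrite !lift_perm_lift !ltn_lift.
Qed.

Lemma lift_perm_inj (n : nat) :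
  injective (fun p : 'I_n.+1 * 'S_n => lift_perm ord0 p.1 p.2).
Proof.
move=> [k s] [l t] /= e.
have kl : k = l by rewrite -(lift_perm_id ord0 k s) e lift_perm_id.
rewrite kl in e *; congr (_, _); apply/permP => i.
by apply: (@lift_inj _ l); rewrite -!(lift_perm_lift ord0) e.
Qed.

Lemma big_lift_perm (V : nmodType) (n : nat) (P : pred 'S_n.+1) (F : 'S_n.+1 -> V) :
  \sum_(s | P s) F s =
  \sum_(s : 'S_n) \sum_(k < n.+1 | P (lift_perm ord0 k s)) F (lift_perm ord0 k s).
Proof.
rewrite (reindex (fun p : 'I_n.+1 * 'S_n => lift_perm ord0 p.1 p.2)).
  by rewrite (exchange_big_dep xpredT) //= pair_big_dep.
apply: onW_bij; apply: inj_card_bij; first exact: lift_perm_inj.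
by rewrite card_prod card_ord !card_Sn.
Qed.

(** * Cauchy products and the recurrence for weighted walks *)

Definition cauchy_prod (R : comNzRingType) (f g : nat -> R) (n : nat) : R :=
  \sum_(i < n.+1) f i * g (n - i)%N.

(** Coefficients up to [n] only see the truncations of the sequences at degree [n], so this is
    associativity of polynomial multiplication. *)
Lemma cauchy_prodA (R : comNzRingType) (f g h : nat -> R) (n : nat) :
  cauchy_prod f (cauchy_prod g h) n = cauchy_prod (cauchy_prod f g) h n.
Proof.
pose P (u : nat -> R) : {poly R} := \poly_(i < n.+1) u i.
have PE u i : (i <= n)%N -> (P u)`_i = u i by move=> i_n; rewrite coef_poly ltnS i_n.
have PM u v i : (i <= n)%N -> (P u * P v)`_i = cauchy_prod u v i.
  move=> i_n; rewrite coefM; apply: eq_bigr => -[j /= j_i] _.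
  by rewrite !PE //; lia.
transitivity (P f * (P g * P h))`_n.
  by rewrite coefM; apply: eq_bigr => -[j /= j_n] _; rewrite PE ?PM //; lia.
by rewrite mulrA coefM; apply: eq_bigr => -[j /= j_n] _; rewrite PE ?PM //; lia.
Qed.

(* Total weight of the ways to prepend n letters, each one at most the current
   prefix cap, starting from prefix cap m; prepending k has weight q ^+ k. *)
Fixpoint prepend_weight (R : comNzRingType) (q : R) (n m : nat) : R :=
  if n is n'.+1 then \sum_(k < m.+1) q ^+ k * prepend_weight q n' k.+1 else 1.

(* First-passage decomposition: i is the number of letters prepended before the
   first one that is at most m. *)
Lemma prepend_weight_conv (R : comNzRingType) (q : R) (n m : nat) :
  prepend_weight q n m.+1 =
  cauchy_prod (fun i => q ^+ (m.+1 * i) * prepend_weight q i 0)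
              (fun i => prepend_weight q i m) n.
Proof.
elim/ltn_ind: n m => -[|n] IH m.
  by rewrite /cauchy_prod big_ord1 muln0 expr0 !mulr1.
(* Split by the first letter: at most [m], or equal to [m + 1], which raises the cap to [m + 2]. *)
have -> : prepend_weight q n.+1 m.+1 =
    prepend_weight q n.+1 m + q ^+ m.+1 * prepend_weight q n m.+2.
  by rewrite /= big_ord_recr.
rewrite [RHS]/cauchy_prod big_ord_recl muln0 expr0 !mul1r subn0; congr (_ + _).
rewrite IH //.
under eq_bigr => i _ do
  rewrite lift0 subSS [prepend_weight q i.+1 0]/= big_ord1 expr0 mul1r IH ?ltn_ord //.
set a := prepend_weight q ^~ 0.
pose f i := q ^+ (m.+2 * i) * a i; pose g i := q ^+ (m.+1 * i) * a i.
(* Getting from cap [m + 2] down to [m] takes two first passages; both sides become the same triple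
   convolution, with exponent (m + 1)(j + 1) + i. *)
transitivity (q ^+ m.+1 * cauchy_prod f (cauchy_prod g (prepend_weight q ^~ m)) n).
  congr (_ * _); apply: eq_bigr => -[i /= i_n] _; congr (_ * _).
  by rewrite IH // ltnS leq_subr.
rewrite cauchy_prodA mulr_sumr; apply: eq_bigr => j _.
rewrite mulrA; congr (_ * _); rewrite !mulr_sumr; apply: eq_bigr => -[i /= i_j] _.
rewrite /f /g /a mul1n !mulrA [X in X * _ = _]mulrAC -!exprD.
by congr (q ^+ _ * _ * _); rewrite /= /bump; nia.
Qed.

(** The Carlitz-Riordan recurrence of the q-Catalan numbers: after a forced letter 0, a first
    passage from cap 1. *)
Lemma prepend_weight_rec (R : comNzRingType) (q : R) (n : nat) :
  prepend_weight q n.+1 0 =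
  cauchy_prod (fun i => q ^+ i * prepend_weight q i 0)
              (fun i => prepend_weight q i 0) n.
Proof.
rewrite /= big_ord1 expr0 mul1r prepend_weight_conv.
by apply: eq_bigr => i _; rewrite mul1n.
Qed.

(** * The inversion enumerator of the avoiders and the Mallows normalization *)

Lemma inv_count_ord0 (s : 'S_0) : inv_count s = 0%N.
Proof. by rewrite inv_countE big_ord0. Qed.

Lemma avoiders_ord0 (s : 'S_0) : s \in avoiders 0 p312.
Proof. by rewrite inE; apply/contains_p312P => -[[]]. Qed.

(** The [j] pending letters make the induction on [n] work: removing the first letter of an avoider
    turns it into one more step of the walk. The case [j = 0] is the inversion enumerator. *)
Lemma sum_avoiders_prepend (R : comNzRingType) (q : R) (n j : nat) :
  \sum_(s in avoiders n p312) q ^+ inv_count s * prepend_weight q j (prefix_cap s) =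
  prepend_weight q (n + j) 0.
Proof.
elim: n j => [|n IH] j.
  transitivity (\sum_(s : 'S_0) prepend_weight q j 0).
    apply: eq_big => s; first by rewrite avoiders_ord0.
    by move=> _; rewrite inv_count_ord0 mul1r.
  by rewrite sumr_const card_Sn mulr1n.
rewrite big_lift_perm addSnnS -IH [RHS]big_mkcond /=.
apply: eq_bigr => s _.
under eq_bigl do rewrite avoiders_lift_perm.
case: ifP => [sav|_] /=; last by rewrite big_pred0.
under eq_bigr do rewrite inv_count_lift_perm lift_perm_id.
have cap : ((prefix_cap s).+1 <= n.+1)%N by rewrite ltnS prefix_cap_le.
rewrite mulr_sumr.
rewrite (big_ord_widen _
  (fun k => q ^+ inv_count s * (q ^+ k * prepend_weight q j k.+1)) cap).
by apply: eq_bigr => k _; rewrite exprD mulrCA mulrA.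
Qed.

Lemma sum_avoiders_inv (R : comNzRingType) (q : R) (n : nat) :
  \sum_(s in avoiders n p312) q ^+ inv_count s = prepend_weight q n 0.
Proof.
rewrite -[n in RHS]addn0 -sum_avoiders_prepend.
by apply: eq_bigr => s _; rewrite mulr1.
Qed.

(** Without the avoidance constraint every letter from 0 to [n] can be prepended to a permutation of
    size [n], which contributes one factor. *)
Lemma mallows_ZE (R : realType) (n : nat) (q : R) :
  mallows_Z n q = \prod_(1 <= l < n.+1) \sum_(i < l) q ^+ i.
Proof.
elim: n => [|n IH]; rewrite /mallows_Z.
  rewrite big_geq //; transitivity (\sum_(s : 'S_0) (1 : R)).
    by apply: eq_bigr => s _; rewrite inv_count_ord0.
  by rewrite sumr_const card_Sn mulr1n.
rewrite big_nat_recr //= -IH big_lift_perm mulr_suml; apply: eq_bigr => s _.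
by rewrite mulr_sumr; apply: eq_bigr => k _; rewrite inv_count_lift_perm exprD mulrC.
Qed.

(** The product of the [1 - q ^+ l] is [(1 - q) ^+ n] times the partition function, so the Mallows
    normalization cancels. *)
Lemma gamma312E (R : realType) (q : R) (n : nat) : 0 < q -> q < 1 ->
  gamma312 q n = (1 - q) ^+ n * prepend_weight q n 0.
Proof.
move=> q0 q1; rewrite /gamma312 /mallows /mallows_pmf -mulr_suml sum_avoiders_inv.
have -> : \prod_(1 <= l < n.+1) (1 - q ^+ l) = (1 - q) ^+ n * mallows_Z n q.
  rewrite mallows_ZE -[n in _ ^+ n]subn0 -subSS -prodr_const_nat -big_split /=.
  apply: eq_bigr => l _; rewrite -[1 in LHS](expr1n _ l) subrXX; congr (_ * _).
  by apply: eq_bigr => i _; rewrite expr1n mul1r.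
rewrite -mulrA; congr (_ * _); rewrite mulrC divfK // gt_eqF //.
rewrite /mallows_Z (bigD1 1%g) //= ltr_wpDr ?exprn_gt0 //.
by apply: sumr_ge0 => s _; rewrite exprn_ge0 // ltW.
Qed.

Lemma prepend_weight_ge0 (R : realType) (q : R) (n m : nat) :
  0 <= q -> 0 <= prepend_weight q n m.
Proof.
move=> q0; elim: n m => [|n IH] m //=.
by apply: sumr_ge0 => k _; rewrite mulr_ge0 ?exprn_ge0.
Qed.

Lemma gamma312_ge0 (R : realType) (q : R) (n : nat) : 0 < q -> q < 1 ->
  0 <= gamma312 q n.
Proof.
move=> q0 q1; rewrite gamma312E // mulr_ge0 ?exprn_ge0 ?prepend_weight_ge0 //.
  by rewrite subr_ge0 ltW.
exact: ltW.
Qed.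

Lemma gamma312_0 (R : realType) (q : R) : 0 < q -> q < 1 -> gamma312 q 0 = 1.
Proof. by move=> q0 q1; rewrite gamma312E // mulr1. Qed.

Lemma gamma312_rec (R : realType) (q : R) (n : nat) : 0 < q -> q < 1 ->
  gamma312 q n.+1 =
  (1 - q) * cauchy_prod (fun i => q ^+ i * gamma312 q i) (gamma312 q) n.
Proof.
move=> q0 q1; rewrite gamma312E // prepend_weight_rec !mulr_sumr.
apply: eq_bigr => -[i /= i_n] _; rewrite !gamma312E //.
rewrite exprS -{1}(subnKC (i_n : (i <= n)%N)) exprD; ring.
Qed.

(** * Partial sums, radius of convergence and convexity of power series *)

Lemma series_cauchy_prod (R : realType) (u v : R ^nat) (n : nat) :
  series (cauchy_prod u v) n = \sum_(i < n) u i * series v (n - i)%N.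
Proof.
elim: n => [|n IH]; first by rewrite /series /= big_geq // big_ord0.
rewrite [LHS]big_nat_recr //= -[X in X + _]/(series (cauchy_prod u v) n) IH.
rewrite [X in _ + X](_ : _ = \sum_(i < n.+1) u i * v (n - i)%N) //.
rewrite [X in X + _](_ : _ = \sum_(i < n.+1) u i * series v (n - i)%N); last first.
  by rewrite big_ord_recr /= subnn [series v 0]big_geq // mulr0 addr0.
rewrite -big_split /=; apply: eq_bigr => -[i /= i_n] _.
by rewrite -mulrDr subSn // [series v _.+1]big_nat_recr.
Qed.

(** The triangle i + j < n lies inside the square i, j < n. *)
Lemma series_cauchy_prod_le (R : realType) (u v : R ^nat) (n : nat) :
  (forall i, 0 <= u i) -> (forall i, 0 <= v i) ->
  series (cauchy_prod u v) n <= series u n * series v n.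
Proof.
move=> u0 v0; rewrite series_cauchy_prod [series u n]big_mkord mulr_suml.
apply: ler_sum => i _; rewrite ler_wpM2l //.
by apply: nondecreasing_series; rewrite ?leq_subr.
Qed.

(** The square i, j < n lies inside the triangle i + j < 2n. *)
Lemma series_cauchy_prod_ge (R : realType) (u v : R ^nat) (n : nat) :
  (forall i, 0 <= u i) -> (forall i, 0 <= v i) ->
  series u n * series v n <= series (cauchy_prod u v) (n + n).
Proof.
move=> u0 v0; rewrite series_cauchy_prod big_split_ord /= -[leLHS]addr0.
rewrite [series u n]big_mkord mulr_suml; apply: lerD.
  apply: ler_sum => i _; rewrite ler_wpM2l //.
  by apply: nondecreasing_series => //; have := ltn_ord i; lia.
apply: sumr_ge0 => i _; rewrite mulr_ge0 //.
by apply: sumr_ge0.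
Qed.

Lemma lt_pseries_radius (R : realType) (a : R ^nat) (t : R) :
  0 <= t -> (t%:E < pseries_radius a)%E -> cvgn (pseries a t).
Proof.
move=> t0 /ereal_sup_gt[_ [x cx <-]]; rewrite lte_fin => tx.
by apply: is_cvg_pseries_inside cx _; rewrite ger0_norm.
Qed.

Lemma le_pseries_radius (R : realType) (a : R ^nat) (t : R) :
  0 <= t -> cvgn (pseries a t) -> (t%:E <= pseries_radius a)%E.
Proof.
by move=> t0 ct; apply: ereal_sup_ubound; exists t => //; rewrite ger0_norm.
Qed.

Lemma pseries_sum_le (R : realType) (a : R ^nat) (x y : R) :
  (forall n, 0 <= a n) -> 0 <= x -> x <= y ->
  cvgn (pseries a x) -> cvgn (pseries a y) -> pseries_sum a x <= pseries_sum a y.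
Proof.
move=> a0 x0 xy cx cy; apply: ler_lim => //; apply: nearW => n.
apply: ler_sum => i _; rewrite ler_wpM2l // lerXn2r // nnegrE //.
exact: le_trans xy.
Qed.

(** In the induction step the gap is l (1 - l) (y - x) (y^n - x^n), where both differences are
    nonnegative. *)
Lemma exprn_convex (R : realFieldType) (n : nat) (l x y : R) :
  0 <= l -> l <= 1 -> 0 <= x -> x <= y ->
  ((1 - l) * x + l * y) ^+ n <= (1 - l) * x ^+ n + l * y ^+ n.
Proof.
move=> l0 l1 x0 xy; elim: n => [|n IH]; first by rewrite !expr0; lra.
have m0 : 0 <= (1 - l) * x + l * y by nra.
rewrite exprS (le_trans (ler_wpM2l m0 IH)) //.
have xyn : x ^+ n <= y ^+ n by rewrite lerXn2r // nnegrE //; exact: le_trans xy.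
rewrite !exprS -subr_ge0.
have -> : (1 - l) * (x * x ^+ n) + l * (y * y ^+ n) -
   ((1 - l) * x + l * y) * ((1 - l) * x ^+ n + l * y ^+ n) =
   (l * (1 - l)) * ((y - x) * (y ^+ n - x ^+ n)) by ring.
by rewrite !mulr_ge0 // subr_ge0.
Qed.

(** Termwise from the convexity of s^(i+1), as the coefficients are nonnegative. Applied to F(s) = s
    G(s), it stands for the convexity of h, since h(t) = F(qt) (1 - q) / q. *)
Lemma mul_pseries_sum_convex (R : realType) (a : R ^nat) (l x y : R) :
  (forall n, 0 <= a n) -> 0 <= l -> l <= 1 -> 0 <= x -> x <= y ->
  cvgn (pseries a y) ->
  ((1 - l) * x + l * y) * pseries_sum a ((1 - l) * x + l * y) <=
  (1 - l) * (x * pseries_sum a x) + l * (y * pseries_sum a y).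
Proof.
move=> a0 l0 l1 x0 xy cy; set z := (1 - l) * x + l * y.
have cvg_le w : 0 <= w -> w <= y -> cvgn (pseries a w).
  move=> w0; rewrite le_eqVlt => /orP[/eqP-> //|wy].
  by apply: is_cvg_pseries_inside cy _; rewrite !ger0_norm // (le_trans x0).
have z0 : 0 <= z by rewrite /z; nra.
have cx := cvg_le x x0 xy.
have cz : cvgn (pseries a z) by apply: cvg_le => //; rewrite /z; nra.
have lim w : cvgn (pseries a w) -> w * pseries a w n @[n --> \oo] --> w * pseries_sum a w.
  by move=> cw; apply: cvgMl_tmp.
have limD : (1 - l) * (x * pseries a x n) + l * (y * pseries a y n) @[n --> \oo] -->
    (1 - l) * (x * pseries_sum a x) + l * (y * pseries_sum a y).
  by apply: cvgD; apply: cvgMl_tmp; exact: lim.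
apply: (ler_cvg_to (lim _ cz) limD); apply: nearW => n.
rewrite /pseries /series /= !mulr_sumr -big_split /=; apply: ler_sum => i _.
have := ler_wpM2l (a0 i) (exprn_convex i.+1 l0 l1 x0 xy).
by rewrite -/z !exprS => h; apply: (le_trans (le_trans _ h)); lra.
Qed.

(** * The functional equation, first for partial sums and then in the limit *)

Lemma pseries_gamma312_rec (R : realType) (q t : R) (n : nat) : 0 < q -> q < 1 ->
  pseries (gamma312 q) t n.+1 =
  1 + series (cauchy_prod (fun i => (1 - q) * t * (gamma312 q i * (q * t) ^+ i))
                          (fun i => gamma312 q i * t ^+ i)) n.
Proof.
move=> q0 q1; rewrite [LHS]big_nat_recl //= gamma312_0 // expr0 mulr1.
congr (_ + _); apply: eq_bigr => i _.
rewrite gamma312_rec // mulr_sumr mulr_suml; apply: eq_bigr => -[j /= j_i] _.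
have ti : t ^+ i = t ^+ j * t ^+ (i - j) by rewrite -exprD subnKC.
by rewrite exprS ti exprMn; ring.
Qed.

Lemma gamma312_term_ge0 (R : realType) (q t : R) (n : nat) : 0 < q -> q < 1 ->
  0 <= t -> 0 <= gamma312 q n * t ^+ n.
Proof. by move=> q0 q1 t0; rewrite mulr_ge0 ?gamma312_ge0 ?exprn_ge0. Qed.

Lemma pseries_gamma312_ge0 (R : realType) (q t : R) (n : nat) : 0 < q -> q < 1 ->
  0 <= t -> 0 <= pseries (gamma312 q) t n.
Proof.
by move=> q0 q1 t0; apply: sumr_ge0 => i _; apply: gamma312_term_ge0.
Qed.

Lemma nondecreasing_pseries_gamma312 (R : realType) (q t : R) : 0 < q -> q < 1 ->
  0 <= t -> nondecreasing_seq (pseries (gamma312 q) t).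
Proof.
move=> q0 q1 t0; apply: nondecreasing_series => n _ _.
by apply: gamma312_term_ge0.
Qed.

Lemma pseries_gamma312_rec_le (R : realType) (q t : R) (n : nat) :
  0 < q -> q < 1 -> 0 <= t ->
  pseries (gamma312 q) t n.+1 <=
  1 + (1 - q) * t * pseries (gamma312 q) (q * t) n * pseries (gamma312 q) t n.
Proof.
move=> q0 q1 t0; rewrite pseries_gamma312_rec // lerD2l.
apply: le_trans (series_cauchy_prod_le _ _ _) _ => [i|i|].
- by apply: mulr_ge0; rewrite ?gamma312_term_ge0 ?mulr_ge0 ?subr_ge0 // ltW.
- by apply: gamma312_term_ge0.
by rewrite [in leLHS]/series /= -mulr_sumr.
Qed.

Lemma pseries_gamma312_rec_ge (R : realType) (q t : R) (n : nat) :
  0 < q -> q < 1 -> 0 <= t ->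
  1 + (1 - q) * t * pseries (gamma312 q) (q * t) n * pseries (gamma312 q) t n <=
  pseries (gamma312 q) t (n + n).+1.
Proof.
move=> q0 q1 t0; rewrite pseries_gamma312_rec // lerD2l.
apply: le_trans (series_cauchy_prod_ge _ _ _) => [|i|i].
- by rewrite [in leRHS]/series /= -mulr_sumr.
- by apply: mulr_ge0; rewrite ?gamma312_term_ge0 ?mulr_ge0 ?subr_ge0 // ltW.
by apply: gamma312_term_ge0.
Qed.

Lemma is_cvg_pseries_scale (R : realType) (a : R ^nat) (q t : R) :
  0 < q -> q < 1 -> 0 <= t -> cvgn (pseries a t) -> cvgn (pseries a (q * t)).
Proof.
move=> q0 q1; rewrite le_eqVlt => /orP[/eqP<-|t0 ct]; first by rewrite mulr0.
apply: is_cvg_pseries_inside ct _.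
by rewrite !ger0_norm ?mulr_ge0 ?(ltW q0) ?(ltW t0) // gtr_pMl.
Qed.

(** Take limits in S_(n+1) <= 1 + h_n S_n <= S_(2n+1), where S_n and h_n are the partial sums of
    G(t) and h(t). *)
Lemma G312_eq (R : realType) (q t : R) : 0 < q -> q < 1 -> 0 <= t ->
  cvgn (pseries (gamma312 q) t) ->
  G312 q t = 1 + (1 - q) * t * G312 q (q * t) * G312 q t.
Proof.
move=> q0 q1 t0 ct; have cqt := is_cvg_pseries_scale q0 q1 t0 ct.
have limR : 1 + (1 - q) * t * pseries (gamma312 q) (q * t) n *
    pseries (gamma312 q) t n @[n --> \oo] -->
    1 + (1 - q) * t * G312 q (q * t) * G312 q t.
  by apply: cvgD; [exact: cvg_cst|apply: cvgM => //; apply: cvgMl_tmp].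
apply/eqP; rewrite eq_le; apply/andP; split.
  have ct1 : pseries (gamma312 q) t n.+1 @[n --> \oo] --> G312 q t.
    by rewrite (cvg_shiftS (pseries (gamma312 q) t)).
  apply: (ler_cvg_to ct1 limR); apply: nearW => n.
  exact: pseries_gamma312_rec_le.
apply: (ler_cvg_to limR (cvg_cst (G312 q t))); apply: nearW => n.
apply: le_trans (pseries_gamma312_rec_ge _ _ _ _) _ => //.
by apply: nondecreasing_cvgn_le => //; exact: nondecreasing_pseries_gamma312.
Qed.

Lemma G312_ge1 (R : realType) (q t : R) : 0 < q -> q < 1 -> 0 <= t ->
  cvgn (pseries (gamma312 q) t) -> 1 <= G312 q t.
Proof.
move=> q0 q1 t0 ct.
have := nondecreasing_cvgn_le (nondecreasing_pseries_gamma312 q0 q1 t0) ct 1%N.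
by rewrite /pseries /series /= big_nat1 gamma312_0 // expr0 mulr1.
Qed.

(** * Divergence at the radius of convergence *)

(** Since S_n <= S_(n+1) <= 1 + h(t) S_n, every partial sum is at most 1 / (1 - h(t)). *)
Lemma is_cvg_pseries_gamma312 (R : realType) (q t : R) : 0 < q -> q < 1 -> 0 <= t ->
  cvgn (pseries (gamma312 q) (q * t)) -> (1 - q) * t * G312 q (q * t) < 1 ->
  cvgn (pseries (gamma312 q) t).
Proof.
move=> q0 q1 t0 cqt h1.
have qt0 : 0 <= q * t by rewrite mulr_ge0 // ltW.
have ndt := nondecreasing_pseries_gamma312 q0 q1 t0.
apply: nondecreasing_is_cvgn => //.
exists (1 - (1 - q) * t * G312 q (q * t))^-1 => _ [n _ <-].
rewrite -[leRHS]mul1r ler_pdivlMr ?subr_gt0 // mulrBr mulr1 lerBlDr.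
apply: le_trans (ndt n n.+1 _) _ => //.
apply: le_trans (pseries_gamma312_rec_le _ _ _ _) _ => //.
rewrite lerD2l mulrC ler_wpM2l ?pseries_gamma312_ge0 // ler_wpM2l //.
  by rewrite mulr_ge0 // subr_ge0 ltW.
by apply: nondecreasing_cvgn_le => //; exact: nondecreasing_pseries_gamma312.
Qed.

Lemma G312_unbounded (R : realType) (q M : R) : 0 < q -> q < 1 ->
  (0 < r312 q)%E -> exists t, [/\ 0 <= t, (t%:E < r312 q)%E & M < G312 q t].
Proof.
move=> q0 q1 r_gt0; apply: contrapT => noM.
have cvgr t : 0 <= t -> (t%:E < r312 q)%E -> cvgn (pseries (gamma312 q) t).
  exact: lt_pseries_radius.
have GM t : 0 <= t -> (t%:E < r312 q)%E -> G312 q t <= M.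
  by move=> t0 tr; rewrite leNgt; apply/negP => MG; apply: noM; exists t.
have M1 : 1 <= M.
  by rewrite (le_trans _ (GM 0 _ _)) // G312_ge1 //; apply: cvgr.
have hM t : 0 <= t -> (t%:E < r312 q)%E ->
    (1 - q) * t * G312 q (q * t) <= 1 - M^-1.
  move=> t0 tr; have ct := cvgr t t0 tr.
  have G1 := G312_ge1 q0 q1 t0 ct.
  have G0 : 0 < G312 q t by exact: lt_le_trans G1.
  have -> : (1 - q) * t * G312 q (q * t) = 1 - (G312 q t)^-1.
    have := G312_eq q0 q1 t0 ct; set h := _ * _ * G312 q (q * t) => e.
    by apply: (mulIf (lt0r_neq0 G0)); rewrite mulrBl mulVf ?lt0r_neq0 //; lra.
  by rewrite lerD2l lerN2 lef_pV2 ?GM // posrE (lt_le_trans _ M1).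
(* If the radius were infinite, t = 1 / (1 - q) would give h(t) = G(qt) >= 1, against [hM]. *)
have [r rE] : exists r, r312 q = r%:E.
  case: (r312 q) r_gt0 hM cvgr => [r _ _ _|_ hM cvgr|//]; first by exists r.
  have t0 : 0 <= (1 - q)^-1 by rewrite invr_ge0 subr_ge0 ltW.
  have := hM _ t0 (ltry _); rewrite mulfV ?subr_eq0 ?gt_eqF // mul1r leNgt.
  case/negP; rewrite (@lt_le_trans _ _ 1) //.
    by rewrite gtrDl oppr_lt0 invr_gt0 (lt_le_trans _ M1).
  rewrite G312_ge1 ?mulr_ge0 ?(ltW q0) //.
  by apply: cvgr; rewrite ?ltry // mulr_ge0 // ltW.
rewrite rE in cvgr GM hM r_gt0; rewrite lte_fin in r_gt0.
(* With F(s) = s G(s), one has h(t) = F(qt) / B, so h(t) < 1 amounts to F(qt) < B. *)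
pose B := q / (1 - q).
have B0 : 0 < B by rewrite divr_gt0 // subr_gt0.
have FB s : 0 <= s -> s < q * r -> s * G312 q s <= (1 - M^-1) * B.
  move=> s0 sqr; have sq0 : 0 <= s / q by rewrite divr_ge0 // ltW.
  have qs : q * (s / q) = s by rewrite mulrC divfK // gt_eqF.
  have sr : ((s / q)%:E < r%:E)%E by rewrite lte_fin ltr_pdivrMr // mulrC.
  have := hM _ sq0 sr; rewrite qs [_ * (s / q)]mulrA mulrAC ler_pdivrMr // => h.
  by rewrite /B mulrA ler_pdivlMr ?subr_gt0 //; nra.
(* A point beyond q r where the series still converges; F(b) is finite but may exceed B. *)
pose b := (q * r + r) / 2.
have qr0 : 0 < q * r by rewrite mulr_gt0.
have qrr : q * r < r by rewrite gtr_pMl.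
have [qrb br] : q * r < b /\ b < r by rewrite /b; split; lra.
have b0 : 0 < b by lra.
have cb : cvgn (pseries (gamma312 q) b) by apply: cvgr; rewrite ?lte_fin ?ltW.
have Fb0 : 0 < b * G312 q b.
  by rewrite mulr_gt0 // (lt_le_trans ltr01) // G312_ge1 // ltW.
have BM0 : 0 < M^-1 * B by rewrite mulr_gt0 // invr_gt0 (lt_le_trans _ M1).
(* This weight makes l F(b) smaller than B / M, the slack left by [FB]. *)
pose l := M^-1 * B / (b * G312 q b + M^-1 * B).
have den0 : 0 < b * G312 q b + M^-1 * B by rewrite addr_gt0.
have l0 : 0 < l by rewrite divr_gt0.
have l1 : l < 1 by rewrite ltr_pdivrMr // mul1r ltrDr.
have lF : l * (b * G312 q b) < M^-1 * B.
  by rewrite mulrAC ltr_pdivrMr // ltr_pM2l // ltrDl.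
(* [a] lies below q r, where [FB] applies, yet close enough for y = (1 - l) a + l b to exceed q r.
   The last factor [q] reduces [0 <= a] to l (b - q r) <= r. *)
pose a := q * r - l * (b - q * r) * q.
have lb0 : 0 < l * (b - q * r) by rewrite mulr_gt0 // subr_gt0.
have a0 : 0 <= a.
  rewrite subr_ge0 mulrC ler_pM2l //.
  by nra.
have aqr : a < q * r by rewrite gtrDl oppr_lt0 mulr_gt0.
pose y := (1 - l) * a + l * b.
have yqr : q * r < y.
  have -> : y = q * r + l * (b - q * r) * (1 - (1 - l) * q) by rewrite /y /a; ring.
  by rewrite ltrDl mulr_gt0 // subr_gt0; nra.
have yb : y <= b by rewrite /y; nra.
have y0 : 0 <= y by rewrite (le_trans _ (ltW yqr)) // ltW.
(* By convexity, F(y) <= (1 - l) F(a) + l F(b) < (1 - 1/M) B + B/M. *)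
have Fy : y * G312 q y < B.
  have c0 n : 0 <= gamma312 q n by exact: gamma312_ge0.
  have ab : a <= b by exact: ltW (lt_trans aqr qrb).
  apply: le_lt_trans (mul_pseries_sum_convex c0 (ltW l0) (ltW l1) a0 ab cb) _.
  rewrite -!/(G312 _ _); have := FB a a0 aqr.
  have : 0 <= a * G312 q a.
    rewrite mulr_ge0 // (le_trans ler01) // G312_ge1 //.
    by apply: cvgr => //; rewrite lte_fin (lt_trans aqr).
  by move: lF; nra.
have t0 : 0 <= y / q by rewrite divr_ge0 // ltW.
have qt : q * (y / q) = y by rewrite mulrC divfK // gt_eqF.
(* The point y / q exceeds r, yet h(y / q) < 1 makes the series converge there. *)
have : cvgn (pseries (gamma312 q) (y / q)).
  apply: is_cvg_pseries_gamma312 => //; rewrite qt.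
    by apply: cvgr => //; rewrite lte_fin (le_lt_trans yb).
  move: Fy; rewrite /B ltr_pdivlMr ?subr_gt0 // => Fy.
  rewrite [_ * (y / q)]mulrA mulrAC ltr_pdivrMr // mul1r.
  by apply: le_lt_trans Fy; lra.
move=> /(le_pseries_radius t0); rewrite -/(r312 q) rE lee_fin leNgt.
by rewrite ltr_pdivlMr // mulrC yqr.
Qed.

(* The limit is taken over x in [0, r312 q) in the
   extended reals; such x are finite, so fine x is the real number x. *)
Theorem proposition5 (R : realType) (q : R) (q_gt0 : 0 < q) (q_lt1 : q < 1) :
  (forall t : R, 0 <= t -> (t%:E < r312 q)%E ->
     G312 q t = 1 / (1 - (1 - q) * t * G312 q (q * t))) /\
  (G312 q (fine x)
     @[x --> within [set x : \bar R | (0 <= x)%E /\ (x < r312 q)%E]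
                    (nbhs (r312 q))] --> +oo).
Proof.
split=> [t t0 tr|].
  have ct := lt_pseries_radius t0 tr.
  have e := G312_eq q_gt0 q_lt1 t0 ct.
  have eM : G312 q t * (1 - (1 - q) * t * G312 q (q * t)) = 1 by lra.
  have D0 : 1 - (1 - q) * t * G312 q (q * t) != 0.
    by apply/eqP => e0; move: eM; rewrite e0 mulr0 => /esym/eqP; rewrite oner_eq0.
  by rewrite -[LHS](mulfK D0) eM.
apply/cvgryPgt => M; rewrite near_withinE.
(* For a radius at most 0, no x is admissible. *)
have [r0|r_gt0] := leP (r312 q) 0%E.
  by apply: nearW => x [x0 xr]; have := lt_le_trans xr r0; rewrite ltNge x0.
(* Past one point [t] where G exceeds [M], monotonicity keeps G above [M] up to the radius, and the
   x above [t] form a neighbourhood of the radius, finite or not. *)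
have [t [t0 tr MG]] := G312_unbounded M q_gt0 q_lt1 r_gt0.
have : nbhs (r312 q) [set x | (t%:E < x)%E].
  by apply: open_nbhs_nbhs; split => //; exact: open_ereal_gt_ereal.
apply: filterS => x /= tx [x0 xr].
have xE : x = (fine x)%:E.
  by case: x tx x0 xr => [||] // _ _; rewrite ltNge leey.
move: tx x0 xr; rewrite xE /= !lte_fin lee_fin => tx x0 xr.
apply: lt_le_trans MG _; apply: pseries_sum_le; rewrite ?(ltW tx) //.
- by move=> n; apply: gamma312_ge0.
- exact: lt_pseries_radius tr.
- exact: lt_pseries_radius xr.
Qed.
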